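(* There exists a $\mathbb{Z}^2$-subshift of finite type $X$ (with the shift action $\sigma$ of $\mathbb{Z}^2$) in the CPE class $2$; that is, $\mathtt{E}_2(X,\sigma)=X^2$ and $\mathtt{E}_1(X,\sigma)\neq X^2$.
   Context: Let $G=\mathbb{Z}^2$. For a finite alphabet $\mathcal A$, a $G$-subshift is a subset $X\subset\mathcal A^{G}$ closed in the product topology and invariant under the shift $\sigma^g(x)_h=x_{g^{-1}h}$; it is of finite type (SFT) if it is the set of all configurations in which no pattern from some fixed finite set of forbidden finite patterns appears. $(X,\sigma)$ is a $G$-topological dynamical system, i.e. a compact metrizable space with a $G$-action $T$ ($=\sigma$) by homeomorphisms. With $\{F_n\}$ a Følner sequence in $G$, for an open cover $\mathcal U$ of $X$ let $h_{\mathrm{top}}(T,\mathcal U)=\lim_n\frac1{|F_n|}\log N(\bigvee_{g\in F_n}T^{g^{-1}}\mathcal U)$, where $N(\cdot)$ is the minimum cardinality of a subcover. A pair $(x,y)\in X^2$ is an entropy pair if $x\neq y$ and for every pair of disjoint closed neighborhoods $U_x,U_y$ of $x$ and $y$ one has $h_{\mathrm{top}}(T,\{X\setminus U_x,X\setminus U_y\})>0$. Let $\mathtt{E}(X,T)$ be the set of entropy pairs and $\Delta$ the diagonal of $X^2$. For $R\subset X^2$, $R^+$ is the smallest equivalence relation on $X$ containing $R$. Define $\mathtt{E}_1(X,T)=\mathtt{E}(X,T)\cup\Delta$ and, for integers $n\ge 2$, $\mathtt{E}_n(X,T)=\overline{\mathtt{E}_{n-1}(X,T)}$ if $\mathtt{E}_{n-1}(X,T)$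 is not closed, and $\mathtt{E}_n(X,T)=\mathtt{E}_{n-1}(X,T)^+$ otherwise. $(X,T)$ is in the CPE class $n$ if $\mathtt{E}_n(X,T)=X^2$ and $\mathtt{E}_m(X,T)\ne X^2$ for all $1\le m<n$. *)

(* Defs.v *)
From HB Require Import structures.
From mathcomp Require Import all_boot all_order all_algebra finmap.
From mathcomp Require Import all_classical all_reals all_analysis.

Set Implicit Arguments.
Unset Strict Implicit.
Unset Printing Implicit Defensive.

Import Order.TTheory GRing.Theory Num.Theory.
Import numFieldNormedType.Exports.

Local Open Scope classical_set_scope.
Local Open Scope ring_scope.

(* The group Z^2, written additively. *)
Notation Z2 := (int * int)%type.

Definition translate (g : Z2) (F : {fset Z2}) : {fset Z2} :=
  [fset (g + h)%R | h in F]%fset.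

Definition symdiff (E F : {fset Z2}) : {fset Z2} :=
  ((E `\` F) `|` (F `\` E))%fset.

Definition Folner (R : realType) (F : nat -> {fset Z2}) : Prop :=
  (forall n, F n != fset0) /\
  (forall g : Z2,
     ((#|` symdiff (translate g (F n)) (F n)|)%:R / (#|` F n|)%:R : R)
       @[n --> \oo] --> (0 : R)).

(* The least element of P, and 0 if P is empty. *)
Definition nat_min (P : set nat) : nat :=
  xget 0%N [set n | P n /\ forall m, P m -> (n <= m)%N].

(* N(V) for a cover V, given as the set of its members. *)
Definition min_subcover (X : Type) (V : set (set X)) : nat :=
  nat_min [set n | exists S : set (set X),
    [/\ S `<=` V, (S #= `I_n)%card & \bigcup_(W in S) W = setT]].

Section Entropy.
Variables (R : realType) (F : nat -> {fset Z2}).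
Variables (X : topologicalType) (T : Z2 -> X -> X).

(* The join over g in D of the covers T^(-g) U; the function u selects a member
   of U for each g in D. *)
Definition join_cover (D : {fset Z2}) (U : set (set X)) : set (set X) :=
  [set W | exists u : Z2 -> set X,
    (forall g, g \in D -> U (u g)) /\
    W = \bigcap_(g in [set` D]) (T (- g) @` u g)].

(* For Folner F and an open cover U of a compact X this limit exists
   (Ornstein-Weiss). *)
Definition htop (U : set (set X)) : R :=
  limn (fun n => ln (min_subcover (join_cover (F n) U))%:R / (#|` F n|)%:R : R).

Definition entropy_pairs : set (X * X) :=
  [set p | p.1 <> p.2 /\
    forall Ux Uy : set X, closed Ux -> nbhs p.1 Ux ->
      closed Uy -> nbhs p.2 Uy -> Ux `&` Uy = set0 ->
      0 < htop [set ~` Ux; ~` Uy]].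

Definition equiv_rel (E : set (X * X)) : Prop :=
  [/\ forall x, E (x, x),
      forall x y, E (x, y) -> E (y, x) &
      forall x y z, E (x, y) -> E (y, z) -> E (x, z)].

Definition equiv_closure (E : set (X * X)) : set (X * X) :=
  smallest equiv_rel E.

(* E_n is meaningful for n >= 1 only; index 0 is a dummy copy of E_1. *)
Fixpoint E_ (n : nat) : set (X * X) :=
  match n with
  | 0 | 1 => entropy_pairs `|` diagonal
  | m.+1 => if `[< closed (E_ m) >] then equiv_closure (E_ m)
            else closure (E_ m)
  end.

Definition CPE_class (n : nat) : Prop :=
  [/\ (1 <= n)%N, E_ n = setT &
      forall m, (1 <= m < n)%N -> E_ m <> setT].

End Entropy.

Section Subshifts.
Variable A : finType.

Definition config := {ptws Z2 -> discrete_topology A}.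

HB.instance Definition _ := Topological.on config.

Definition sigma (g : Z2) (x : config) : config := fun h => x (- g + h).

Record subshift := Subshift {
  carrier :> set config;
  carrier_closed : closed carrier;
  carrier_shift : forall g x, carrier x -> carrier (sigma g x) }.

(* The carrier, as a type, has the subspace topology. *)
Definition subshift_act (X : subshift) (g : Z2) (x : set_type X) : set_type X :=
  exist _ (sigma g (val x)) (mem_set (carrier_shift g (set_valP x))).

(* A finite pattern is a finitely supported partial map from Z^2 to A. *)
Definition appears (p : {fmap Z2 -> A}) (x : config) : Prop :=
  exists g : Z2, forall h, h \in domf p -> p.[? h]%fmap = Some (x (g + h)).

Definition is_SFT (X : set config) : Prop :=
  exists P : {fset {fmap Z2 -> A}},
    X = [set x | forall p, p \in P -> ~ appears p x].

End Subshifts.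

(* Main.v *)
Require Import Defs.
From HB Require Import structures.
From mathcomp Require Import all_boot all_order all_algebra finmap.
From mathcomp Require Import all_classical all_reals all_analysis.
From mathcomp Require Import zify ring lra.

Set Implicit Arguments.
Unset Strict Implicit.
Unset Printing Implicit Defensive.

Import Order.TTheory GRing.Theory Num.Theory.
Import numFieldNormedType.Exports.

Local Open Scope classical_set_scope.
Local Open Scope ring_scope.

(** Let an H-path be a set of cells in which every cell has another cell of the
    set two columns to its right and one two columns to its left, at a height
    differing by at most one; a V-path is the transposed notion. Configurations
    carry an H, a V, or nothing at each site; H cells must form H-paths, V cells
    must form V-paths, and an H and a V never occur within distance one. This is
    a subshift of finite type, [path_subshift].

    An H-path and a V-path always cross: walking along whichever of the two
    advances in the dominant direction decreases the distance between an H cell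
    and a V cell, so both cannot occur in one configuration ([no_crossing]). Let
    Ux and Uy be the cylinders of an H and of a V at the origin. A point never
    visits both, hence two members of each join of the cover by their
    complements suffice, and that cover has zero entropy: the full H and the
    full V configurations are not an entropy pair.

    On the other hand every nonempty point [x] forms an entropy pair with the
    empty configuration. A large pattern of [x] consists of pieces of paths,
    which can be bent until all of them leave through a corridor passing just
    beside the pattern. Such bent copies may be placed, or not, at each site of
    a sparse sublattice, independently, because the corridors avoid the other
    sites ([splice_agree]). As every finite set meets some coset of the
    sublattice in a fixed proportion, this independence bounds the number of
    members of a subcover below exponentially in the size of the Folner sets.

    So every point is related to the empty one, and the equivalence closure of
    the entropy pairs is everything. The relation of entropy pairs together with
    the diagonal is closed in any system ([closed_entropy_pairs]), so the second
    relation of the hierarchy is this equivalence closure.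

    A lower bound for the terms of a sequence bounds its limit only if the limit
    exists, and the Folner sequence is arbitrary. Existence is the theorem of
    Ornstein and Weiss ([ornstein_weiss]), proved by quasi-tilings: a very
    invariant set is covered, up to a small proportion and with small overlap,
    by translates of finitely many earlier Folner sets on which the average is
    nearly the lower limit. *)

(** * Translates and boundaries of finite subsets of the plane *)

Lemma in_translate (g c : Z2) (K : {fset Z2}) :
  (c \in translate g K) = (c - g \in K).
Proof.
apply/imfsetP/idP => /= [[h hK ->]|cK]; first by rewrite addrC addKr.
by exists (c - g) => //; rewrite addrC subrK.
Qed.

Lemma in_symdiff (c : Z2) (E F : {fset Z2}) :
  (c \in symdiff E F) = (c \in E) (+) (c \in F).
Proof.
by rewrite /symdiff in_fsetU !in_fsetD; case: (c \in E) (c \in F) => [] [].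
Qed.

Lemma card_translate (g : Z2) (K : {fset Z2}) : #|` translate g K| = #|` K|.
Proof. by rewrite /translate card_imfset//; exact: addrI. Qed.

Lemma card_fset_sep (T : choiceType) (A : {fset T}) (P : pred T) :
  #|` [fset c in A | P c]%fset| = (\sum_(c <- A) P c)%N.
Proof.
rewrite card_fset_sum1 big_fset/= [LHS]big_mkcond/=.
by apply: eq_bigr => c _; case: (P c).
Qed.

Lemma card_bigfcup_le (T : choiceType) (I : Type) (s : seq I)
    (H : I -> {fset T}) (D : {fset T}) :
  (forall c, c \in D -> has (fun i => c \in H i) s) ->
  (#|` D| <= \sum_(i <- s) #|` H i|)%N.
Proof.
elim: s D => [|i s IH] D HD.
  rewrite big_nil leqn0 cardfs_eq0; apply/eqP/fsetP => c.
  by rewrite in_fset0; apply/negP => /HD.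
rewrite big_cons -(cardfsID (H i) D) leq_add//.
  by apply: fsubset_leq_card; exact: fsubsetIr.
apply: IH => c; rewrite in_fsetD => /andP[/negbTE cH /HD] /=.
by rewrite cH.
Qed.

(** The difference set [A - K]: the [g] at which [translate g K] meets [A]. *)
Definition outer (K A : {fset Z2}) : {fset Z2} :=
  [fset (c - k)%R | c in A, k in K]%fset.

(** Count the pairs of a cell of [A] and a translate of [K] containing it: each
    cell lies in as many translates as [K] has elements, all of them placed in
    [outer K A]. *)
Lemma card_outer_ge (K A : {fset Z2}) :
  (#|` A| * #|` K| <= \sum_(g <- outer K A) #|` (A `&` translate g K)%fset|)%N.
Proof.
have -> : (\sum_(g <- outer K A) #|` (A `&` translate g K)%fset| =
           \sum_(g <- outer K A) \sum_(c <- A) ((c - g)%R \in K))%N.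
  apply: eq_bigr => g _; rewrite -card_fset_sep; congr (#|` _|).
  by apply/fsetP => c; rewrite !inE/= in_translate.
rewrite exchange_big/= card_fset_sum1 big_distrl/= big_seq [leqRHS]big_seq.
apply: leq_sum => c cA; rewrite mul1n -card_fset_sep.
have <- : #|` [fset (c - k)%R | k in K]%fset| = #|` K|.
  by rewrite card_imfset//= => k k' /addrI/oppr_inj.
apply: fsubset_leq_card; apply/fsubsetP => _ /imfsetP[k /= kK ->].
rewrite !inE/= subKr kK andbT; apply/imfset2P; exists c => //; by exists k.
Qed.

Definition outer_bd (K A : {fset Z2}) : {fset Z2} := (outer K A `\` A)%fset.

Definition inner_bd (K A : {fset Z2}) : {fset Z2} :=
  [fset c in A | has (fun k => (c + k)%R \notin A) K]%fset.

(** Removing [T] creates boundary only inside [T], at cells from which a step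
    of [K] leaves [T]. *)
Lemma outer_bd_remove (K A T : {fset Z2}) :
  (#|` outer_bd K (A `\` T)%fset| <= #|` outer_bd K A| + #|` inner_bd K T|)%N.
Proof.
apply: leq_trans (leq_card_fsetU _ _).1.
apply: fsubset_leq_card; apply/fsubsetP => c.
rewrite !inE/= => /andP[+ /imfset2P[/= a + [k kK cE]]].
rewrite !inE/= => cN /andP[aT aA].
have cO : c \in outer K A by apply/imfset2P; exists a => //; exists k.
rewrite cO; case: (boolP (c \in A)) cN => //= cA; rewrite andbT negbK => ->/=.
by apply/hasP; exists k => //; rewrite cE subrK.
Qed.

Lemma card_inner_bd_translate g (K T : {fset Z2}) :
  #|` inner_bd K (translate g T)| = #|` inner_bd K T|.
Proof.
rewrite -[RHS](card_translate g); congr (#|` _|); apply/fsetP => c.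
rewrite !in_translate !inE/= in_translate; congr (_ && _).
by apply: eq_in_has => k _; rewrite in_translate addrAC.
Qed.

Lemma card_outer_bd_le (K B : {fset Z2}) :
  (#|` outer_bd K B| <= \sum_(k <- K) #|` symdiff (translate (- k) B) B|)%N.
Proof.
apply: card_bigfcup_le => c.
rewrite /outer_bd in_fsetD => /andP[cB /imfset2P[/= a aB [k kK cE]]].
apply/hasP; exists k => //.
by rewrite in_symdiff in_translate opprK cE subrK aB -cE (negbTE cB).
Qed.

Lemma card_inner_bd_le (K B : {fset Z2}) :
  (#|` inner_bd K B| <= \sum_(k <- K) #|` symdiff (translate (- k) B) B|)%N.
Proof.
apply: card_bigfcup_le => c.
rewrite /inner_bd in_fset/= inE/= => /andP[cB /hasP[/= k kK ck]].
apply/hasP; exists k => //.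
by rewrite in_symdiff in_translate opprK cB (negbTE ck).
Qed.

(** * Quasi-tilings *)

Lemma one_minus_gt0 (R : realType) (t : R) : t <= 2^-1 -> 0 < 1 - t.
Proof.
have h : 2^-1 < 1 :> R by rewrite invf_lt1 ?ltr1n.
by move=> t2; rewrite subr_gt0 (le_lt_trans t2).
Qed.

Section QuasiTiling.
Variables (R : realType) (phi : {fset Z2} -> R).
Hypothesis phi_mono : forall D E, (D `<=` E)%fset -> phi D <= phi E.
Hypothesis phi_subadd : forall D E, phi (D `|` E)%fset <= phi D + phi E.
Hypothesis phi_translate : forall g D, phi (translate g D) = phi D.

Local Notation "\# A" := (#|` A%fset|%:R : R) (at level 5, A at level 5).

Variables (beta theta eta : R) (B : {fset Z2}).
Hypotheses (beta_ge0 : 0 <= beta) (theta_gt0 : 0 < theta).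
Hypotheses (theta_le : theta <= 2^-1) (eta_ge0 : 0 <= eta).

Let theta_lt1 : 0 < 1 - theta.
Proof. exact: one_minus_gt0. Qed.

Let theta_le1 : 0 <= 1 - theta. Proof. exact: ltW. Qed.

(** What remains of [B] after removing tiles: the cost so far is at most [beta]
    per covered cell, and the remainder is still nearly invariant under the
    tiles [Ks] yet to be used. The boundary term charges each removed tile with its
    own inner boundary; the factor 2 is there because a tile covers at least
    half of its size in new cells. *)
Definition partially_tiled (Ks : seq {fset Z2}) (A : {fset Z2}) : Prop :=
  [/\ (A `<=` B)%fset,
      phi B <= phi A + beta * (\# B - \# A) &
      forall K, K \in Ks ->
        \# (outer_bd K A) <= eta * (\# B + 2 * (\# B - \# A))].

(** The factor [1 - theta] in the cost is the proportion of new cells that a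
    tile is guaranteed to cover when it is used. *)
Definition good_tile (Ks : seq {fset Z2}) (K : {fset Z2}) : Prop :=
  [/\ K != fset0, phi K <= beta * (1 - theta) * \# K &
      forall K', K' \in Ks -> \# (inner_bd K' K) <= eta * \# K].

Lemma partially_tiled_step Ks K A g : good_tile Ks K ->
  partially_tiled Ks A -> (1 - theta) * \# K <= \# (A `&` translate g K) ->
  partially_tiled Ks (A `\` translate g K)%fset.
Proof.
move=> [K0 Kphi Kbd] [AB Aphi Abd] gK.
set T := translate g K; set A' := (A `\` T)%fset.
have cA : \# A = \# (A `&` T) + \# A' by rewrite -natrD cardfsID.
split.
- by apply: fsubset_trans AB; exact: fsubsetDl.
- apply: le_trans Aphi _.
  have : phi A <= phi A' + phi K.
    rewrite -(phi_translate g K) -/T; apply: le_trans (phi_subadd _ _).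
    apply: phi_mono; apply/fsubsetP => c; rewrite !inE.
    by case: (c \in A) (c \in T) => [] [].
  have : beta * ((1 - theta) * \# K) <= beta * \# (A `&` T).
    exact: ler_wpM2l.
  rewrite mulrA cA; move: Kphi; rewrite -/T; nra.
- move=> K' K'Ks; have := Abd _ K'Ks; have := Kbd _ K'Ks.
  have := outer_bd_remove K' A T.
  rewrite card_inner_bd_translate -(ler_nat R) natrD.
  have : (eta * \# K) <= eta * (2 * \# (A `&` T)).
    apply: ler_wpM2l => //.
    have : 0 <= (2^-1 - theta) * \# K by rewrite mulr_ge0// subr_ge0.
    by move: gK; rewrite -/T; lra.
  rewrite cA -/A'; nra.
Qed.

(** If no translate of [K] meets [A] in a proportion [1 - theta] of [K], average
    over the translates that meet [A] at all. *)
Lemma untiled_small K A : K != fset0 ->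
  (forall g, \# (A `&` translate g K) < (1 - theta) * \# K) ->
  \# A <= (1 - theta) * \# (outer K A).
Proof.
move=> K0 gK; have cK : 0 < \# K by rewrite ltr0n cardfs_gt0.
have := card_outer_ge K A; rewrite -(ler_nat R) natrM natr_sum => h.
rewrite -(ler_pM2r cK); apply: le_trans h _.
apply: (@le_trans _ _ (\sum_(g <- outer K A) (1 - theta) * \# K)).
  by apply: ler_sum => g _; exact: ltW.
by rewrite big_const_seq count_predT iter_addr_0 -[X in X <= _]mulr_natr mulrAC.
Qed.

(** Remove translates of [K] greedily. When none covers enough new cells, the
    remainder is at most [1 - theta] times its outer set, by [untiled_small],
    and the outer set of [A] is hardly larger than [A]. *)
Lemma tile_stage Ks K A : good_tile Ks K -> partially_tiled (K :: Ks) A ->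
  exists2 A', partially_tiled Ks A' &
              \# A' <= (1 - theta) * (\# A + 3 * eta * \# B).
Proof.
move=> Kgood tA; have [AB _ Abd] := tA.
have {}tA : partially_tiled Ks A.
  by case: tA => ? ? H; split=> // K' K'Ks; apply: H; rewrite inE K'Ks orbT.
have outA : \# (outer K A) <= \# A + 3 * eta * \# B.
  apply: (@le_trans _ _ (\# A + \# (outer_bd K A))).
    rewrite -natrD ler_nat; apply: leq_trans (leq_card_fsetU _ _).1.
    apply: fsubset_leq_card; apply/fsubsetP => c cO.
    by rewrite !inE cO andbT orbN.
  rewrite lerD2l; apply: le_trans (Abd K _) _; first by rewrite inE eqxx.
  have : 0 <= eta * \# A by rewrite mulr_ge0.
  by lra.
have outS A' : (A' `<=` A)%fset -> (outer K A' `<=` outer K A)%fset.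
  move=> /fsubsetP sA; apply/fsubsetP => _ /imfset2P[c /= /sA cA [k kK ->]].
  by apply/imfset2P; exists c => //; exists k.
suff H n A' : (#|` A'| < n)%N -> (A' `<=` A)%fset -> partially_tiled Ks A' ->
    exists2 A'', partially_tiled Ks A'' &
              \# A'' <= (1 - theta) * \# (outer K A).
  have [A' ? hA'] := H _ _ (ltnSn #|` A|) (fsubset_refl A) tA.
  exists A' => //; apply: le_trans hA' _.
  exact: ler_wpM2l.
elim: n A' => // n IH A' cA' sA' tA'.
have [K0 _ _] := Kgood.
have [/(untiled_small K0) small|] := pselect (forall g,
    \# (A' `&` translate g K) < (1 - theta) * \# K).
  exists A' => //; apply: le_trans small _.
  rewrite ler_wpM2l//.
  by rewrite ler_nat fsubset_leq_card// outS.
move=> /existsNP[g /negP]; rewrite -leNgt => gK.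
apply: (IH (A' `\` translate g K)%fset).
- rewrite -ltnS; apply: leq_trans cA'; rewrite ltnS.
  rewrite -[ltnRHS](cardfsID (translate g K)) -[ltnLHS]add0n ltn_add2r.
  rewrite -(ltr0n R); apply: lt_le_trans gK; apply: mulr_gt0 => //.
  by rewrite ltr0n cardfs_gt0.
- by apply: fsubset_trans sA'; exact: fsubsetDl.
- exact: partially_tiled_step.
Qed.

(** Tiles are listed in order of use, so each one must be nearly invariant under
    those that follow it. *)
Fixpoint good_tiles (Ks : seq {fset Z2}) : Prop :=
  if Ks is K :: Ks' then good_tile Ks' K /\ good_tiles Ks' else True.

(** Each stage sends a size [t] to at most [(1 - theta) * (t + theta * c)] with
    [c] as subtracted below, so the excess over [c] contracts. *)
Lemma quasi_tiling Ks A : good_tiles Ks -> partially_tiled Ks A ->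
  exists2 A', partially_tiled [::] A' &
    \# A' - 3 * eta / theta * \# B <=
      (1 - theta) ^+ size Ks * (\# A - 3 * eta / theta * \# B).
Proof.
elim: Ks A => [|K Ks IH] A /=.
  by move=> _ tA; exists A => //; rewrite expr0 mul1r.
move=> [Kgood Ksgood] /(tile_stage Kgood)[A1 tA1 hA1].
have [A2 tA2 hA2] := IH _ Ksgood tA1; exists A2 => //.
apply: le_trans hA2 _.
have e : 3 * eta * \# B = theta * (3 * eta / theta * \# B).
  by field; rewrite gt_eqF.
have : 0 <= 3 * eta / theta * \# B by rewrite !mulr_ge0// invr_ge0 ltW.
move: hA1; rewrite e; set c := 3 * eta / theta * _ => hA1 c0.
rewrite exprSr -mulrA ler_wpM2l ?exprn_ge0//.
have t0 := ltW theta_gt0; have := mulr_ge0 (mulr_ge0 t0 t0) c0.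
nra.
Qed.

End QuasiTiling.

(** * The Ornstein-Weiss theorem in the plane *)

Lemma near_all_seq (T : eqType) (s : seq T) (P : T -> nat -> Prop) :
  (forall t, \forall n \near \oo, P t n) ->
  \forall n \near \oo, forall t, t \in s -> P t n.
Proof.
move=> HP; elim: s => [|u s IH]; first exact: nearW.
near=> n => t; rewrite inE => /predU1P[->|]; first by near: n.
by move: t; near: n.
Unshelve. all: by end_near.
Qed.

Section OrnsteinWeiss.
Variables (R : realType) (phi : {fset Z2} -> R) (F : nat -> {fset Z2}).
Hypothesis phi0 : phi fset0 = 0.
Hypothesis phi_mono : forall D E, (D `<=` E)%fset -> phi D <= phi E.
Hypothesis phi_subadd : forall D E, phi (D `|` E)%fset <= phi D + phi E.
Hypothesis phi_translate : forall g D, phi (translate g D) = phi D.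
Hypothesis folF : Folner R F.

Local Notation "\# A" := (#|` A%fset|%:R : R) (at level 5, A at level 5).

Lemma phi_ge0 D : 0 <= phi D.
Proof. by rewrite -phi0 phi_mono. Qed.

Lemma phi_le_card D : phi D <= phi [fset (0 : Z2)]%fset * \# D.
Proof.
have [n] := ubnP #|` D|; elim: n D => // n IH D.
have [->|/fset0Pn[c cD]] := eqVneq D fset0.
  by rewrite phi0 cardfs0 mulr0.
rewrite (cardfsD1 c) cD add1n ltnS => Dn.
rewrite -natr1 mulrDr mulr1 -[X in phi X](fsetD1K cD) addrC.
apply: le_trans (phi_subadd _ _) _; apply: lerD; last exact: IH.
have -> : [fset c]%fset = translate c [fset 0]%fset.
  by apply/fsetP => z; rewrite in_translate !inE subr_eq0.
by rewrite phi_translate.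
Qed.

Lemma folner_gt0 n : 0 < \# (F n).
Proof. by rewrite ltr0n cardfs_gt0; exact: folF.1. Qed.

Lemma folner_invariant (K : {fset Z2}) (eta : R) : 0 < eta ->
  \forall n \near \oo,
    \# (inner_bd K (F n)) <= eta * \# (F n) /\
    \# (outer_bd K (F n)) <= eta * \# (F n).
Proof.
move=> eta0.
pose r n := \sum_(k <- K) \# (symdiff (translate (- k) (F n)) (F n)) / \# (F n).
have r0 : r n @[n --> \oo] --> (0 : R).
  rewrite /r; elim: (K : seq Z2) => [|k s IH].
    by under eq_fun do rewrite big_nil; exact: cvg_cst.
  under eq_fun do rewrite big_cons.
  have := cvgD (folF.2 (- k)) IH; rewrite addr0 => h; exact: h.
have : \forall n \near \oo, r n <= eta by exact: cvgr_le r0 _ _.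
apply: filterS => n; rewrite /r -mulr_suml ler_pdivrMr ?folner_gt0//.
rewrite -natr_sum => h; split; apply: le_trans h; rewrite ler_nat.
  exact: card_inner_bd_le.
exact: card_outer_bd_le.
Qed.

Section Upper.
Variables (v theta eta : R).
Hypotheses (v_ge0 : 0 <= v) (theta_gt0 : 0 < theta) (theta_le : theta <= 2^-1).
Hypothesis eta_gt0 : 0 < eta.
Hypothesis v_often :
  forall m, exists2 n, (m <= n)%N & phi (F n) <= v * \# (F n).

Let theta_lt1 : 0 < 1 - theta.
Proof. exact: one_minus_gt0. Qed.

Let beta := v / (1 - theta).

(** Each new tile is a later Folner set, late enough to be nearly invariant
    under the tiles chosen before it; those are used after it. *)
Lemma folner_good_tiles k :
  exists2 Ks, size Ks = k & good_tiles phi beta theta eta Ks.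
Proof.
elim: k => [|k [Ks sKs gKs]]; first by exists [::].
have [m _ Hm] : \forall n \near \oo, forall K, K \in Ks ->
    \# (inner_bd K (F n)) <= eta * \# (F n) /\
    \# (outer_bd K (F n)) <= eta * \# (F n).
  by apply: near_all_seq => K; exact: folner_invariant.
have [n mn vn] := v_often m.
exists (F n :: Ks); first by rewrite /= sKs.
split=> //; split.
- exact: folF.1.
- by rewrite /beta divfK// gt_eqF.
- by move=> K KKs; have [] := Hm n mn K KKs.
Qed.

(** The tiles cost [beta] per cell; the cells left by [quasi_tiling] are covered
    one by one. *)
Lemma folner_tiling_bound k : \forall n \near \oo,
  phi (F n) <= (beta + phi [fset (0 : Z2)]%fset *
    ((1 - theta) ^+ k + 3 * eta / theta)) * \# (F n).
Proof.
have [Ks <- gKs] := folner_good_tiles k.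
have beta0 : 0 <= beta by rewrite divr_ge0// ltW.
have : \forall n \near \oo, forall K, K \in Ks ->
    \# (inner_bd K (F n)) <= eta * \# (F n) /\
    \# (outer_bd K (F n)) <= eta * \# (F n).
  by apply: near_all_seq => K; exact: folner_invariant.
apply: filterS => n Hn.
have tB : partially_tiled phi beta eta (F n) Ks (F n).
  split; first exact: fsubset_refl.
    by rewrite subrr mulr0 addr0.
  by move=> K /Hn[_]; rewrite subrr mulr0 addr0.
have [A [_ hA _] cA] := quasi_tiling phi_mono phi_subadd phi_translate
  beta0 theta_gt0 theta_le (ltW eta_gt0) gKs tB.
apply: le_trans hA _; rewrite mulrDl addrC lerD//.
  by rewrite ler_wpM2l// gerBl.
apply: le_trans (phi_le_card A) _; rewrite -mulrA ler_wpM2l ?phi_ge0//.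
move: cA; set q := _ ^+ _; set c := 3 * eta / theta => cA.
have cF : 0 <= q * (c * \# (F n)).
  by rewrite !mulr_ge0 ?exprn_ge0 ?invr_ge0// ltW.
have := cA; nra.
Qed.

End Upper.

(** If the averages fall below [v] infinitely often, those sets are good tiles
    for every later one, so the averages eventually stay below [v + e]. *)
Lemma folner_limsup_le (v e : R) : 0 <= v -> 0 < e ->
  (forall m, exists2 n, (m <= n)%N & phi (F n) <= v * \# (F n)) ->
  \forall n \near \oo, phi (F n) / \# (F n) <= v + e.
Proof.
move=> v0 e0 v_often; set C := phi [fset (0 : Z2)]%fset.
have C0 : 0 <= C by exact: phi_ge0.
(* Three losses of at most [e / 3] each: the overlaps of tiles, which turn [v]
   into [v / (1 - theta)], the cells left after [k] stages, and boundaries. *)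
pose theta : R := Num.min 2^-1 (e / (6 * (v + 1))).
have theta0 : 0 < theta.
  by rewrite lt_min invr_gt0 ltr0n/= divr_gt0// mulr_gt0// ltr_wpDl.
have thle : theta <= 2^-1 by rewrite ge_min lexx.
have thle2 : theta * (6 * (v + 1)) <= e.
  rewrite -ler_pdivlMr; last by rewrite mulr_gt0// ltr_wpDl.
  by rewrite ge_min lexx orbT.
have theta1 : 0 < 1 - theta by exact: one_minus_gt0.
pose eta := e * theta / (9 * (C + 1)).
have C1 : 0 < 9 * (C + 1) by rewrite mulr_gt0// ltr_wpDl.
have eta0 : 0 < eta by rewrite divr_gt0// mulr_gt0.
have [k _ /(_ k (leqnn k)) hk] :
    \forall k \near \oo, (1 - theta) ^+ k <= e / (3 * (C + 1)).
  have : (1 - theta) ^+ k @[k --> \oo] --> (0 : R).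
    by apply: cvg_expr; rewrite ger0_norm ?ltW// gtrBl.
  move=> /cvgr_le; apply; rewrite divr_gt0// mulr_gt0// ltr_wpDl//.
have := folner_tiling_bound v0 theta0 thle eta0 v_often k.
apply: filterS => n; rewrite -ler_pdivrMr ?folner_gt0// => /le_trans; apply.
have b1 : v / (1 - theta) <= v + e / 3.
  rewrite ler_pdivrMr//.
  have h3 : 0 <= (2^-1 - theta) * e by rewrite mulr_ge0 ?subr_ge0// ltW.
  by lra.
have b2 : C * (1 - theta) ^+ k <= e / 3.
  apply: (@le_trans _ _ (C * (e / (3 * (C + 1))))); first exact: ler_wpM2l.
  rewrite mulrA ler_pdivrMr; last by rewrite mulr_gt0// ltr_wpDl.
  by lra.
have b3 : C * (3 * eta / theta) <= e / 3.
  have -> : C * (3 * eta / theta) = C * e / (3 * (C + 1)).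
    by rewrite /eta; field; rewrite !gt_eqF// ltr_wpDl.
  rewrite ler_pdivrMr; last by rewrite mulr_gt0// ltr_wpDl.
  by lra.
rewrite -/C mulrDr; lra.
Qed.

(** The limit is the infimum of the levels below which the averages fall
    infinitely often. *)
Theorem ornstein_weiss : cvgn (fun n => phi (F n) / \# (F n)).
Proof.
pose a n := phi (F n) / \# (F n).
have a0 n : 0 <= a n by rewrite divr_ge0 ?phi_ge0.
pose V : set R := [set v | 0 <= v /\
  forall m, exists2 n, (m <= n)%N & phi (F n) <= v * \# (F n)].
have VC : V (phi [fset (0 : Z2)]%fset).
  by split=> [|m]; [exact: phi_ge0|exists m => //; exact: phi_le_card].
have Vlb : has_inf V.
  by split; [exists (phi [fset (0 : Z2)]%fset)|exists 0 => v []].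
apply/cvg_ex; exists (inf V).
apply/cvgrPdist_le => e e0.
have e20 : 0 < e / 2 by rewrite divr_gt0.
have [v [v0 Vv] vlt] := inf_adherent e20 Vlb.
have up := folner_limsup_le v0 e20 Vv.
have lo : \forall n \near \oo, inf V - e <= a n.
  have [neg|pos] := ltP (inf V - e) 0.
    by near=> n; apply: le_trans (a0 n); exact: ltW.
  apply: contrapT => H.
  have : V (inf V - e).
    split=> // m; apply: contrapT => /forall2NP Hm; apply: H.
    exists m => // n /= mn; have [//|/negP] := Hm n.
    by rewrite -ltNge -ltr_pdivlMr ?folner_gt0// => /ltW.
  move=> /(ge_inf Vlb.2); rewrite lerDl oppr_ge0 leNgt e0//.
near=> n; rewrite ler_distlC; apply/andP; split; first by near: n.
have : a n <= v + e / 2 by near: n.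
rewrite /a; lra.
Unshelve. all: by end_near.
Qed.

End OrnsteinWeiss.

(** A set nearly invariant under a horizontal segment contains a translate of
    that segment. *)
Lemma folner_card_unbounded (R : realType) (F : nat -> {fset Z2}) (M : nat) :
  Folner R F -> \forall n \near \oo, (M <= #|` F n|)%N.
Proof.
move=> folF; pose K : {fset Z2} := [fset (i%:Z, 0) | i in iota 0 M]%fset.
have cK : #|` K| = M.
  rewrite card_imfset/=; last by move=> i j [].
  by rewrite undup_id ?size_iota ?iota_uniq.
have h2 : 0 < 2^-1 :> R by rewrite invr_gt0.
have := folner_invariant folF K h2; apply: filterS => n [+ _].
have F0 := folner_gt0 folF n.
have [/eqP FE|] := eqVneq (inner_bd K (F n)) (F n).
  by move: F0; rewrite (eqP FE); lra.
move=> neq _.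
have /fset0Pn[c] : (F n `\` inner_bd K (F n) != fset0)%fset.
  rewrite fsetD_eq0; apply: contra neq => sub.
  rewrite eqEfsubset sub andbT; apply/fsubsetP => c.
  by rewrite /inner_bd in_fset/= inE => /andP[].
rewrite in_fsetD /inner_bd in_fset/= inE/= => /andP[+ cF].
rewrite cF/= -all_predC => /allP/= cK'.
have <- : #|` translate c K| = M by rewrite card_translate.
apply: fsubset_leq_card; apply/fsubsetP => z.
by rewrite in_translate => /cK'; rewrite negbK addrC subrK.
Qed.

(** * Minimal subcovers of the joins *)

Lemma nat_minP (P : set nat) n : P n -> P (nat_min P) /\ (nat_min P <= n)%N.
Proof.
move=> Pn; have exP : exists n, `[< P n >] by exists n; apply/asboolP.
have [m /asboolP Pm mmin] := ex_minnP exP.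
have : [set n | P n /\ forall m, P m -> (n <= m)%N] (nat_min P).
  apply: (@xgetPex _ 0%N [set n | P n /\ forall m, P m -> (n <= m)%N]).
  by exists m; split=> // k Pk; apply: mmin; apply/asboolP.
by move=> [Pmin minP]; split=> //; exact: minP.
Qed.

Section CoverNumber.
Variables (X : topologicalType) (T : Z2 -> X -> X).
Hypothesis T0 : forall x, T 0 x = x.
Hypothesis TD : forall g h x, T (g + h) x = T g (T h x).
Variables (A B : set X).
Hypothesis AB : A `|` B = setT.

Let U : set (set X) := [set A; B].

Definition cover_number (D : {fset Z2}) : nat :=
  min_subcover (join_cover T D U).

Definition subcover_sizes (D : {fset Z2}) : set nat :=
  [set n | exists S : set (set X),
    [/\ S `<=` join_cover T D U, (S #= `I_n)%card & \bigcup_(W in S) W = setT]].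

(** A cover by members of the join, presented by the choice of a member of the
    two-set cover at each time; distinct indices may give the same set. *)
Definition indexed_cover (D : {fset Z2}) (I : Type) (w : I -> Z2 -> set X) :=
  (forall i g, g \in D -> U (w i g)) /\
  forall z, exists i, forall g, g \in D -> w i g (T g z).

Lemma preimage_act g (C : set X) : T (- g) @` C = T g @^-1` C.
Proof.
apply/seteqP; split=> [_ [x Cx <-]|x Cx] /=.
  by rewrite -TD subrr T0.
by exists (T g x) => //; rewrite -TD addNr T0.
Qed.

Lemma join_member (D : {fset Z2}) (w : Z2 -> set X) z :
  (\bigcap_(g in [set` D]) (T (- g) @` w g)) z <->
  forall g, g \in D -> w g (T g z).
Proof.
by split=> H g gD; have := H g gD; rewrite preimage_act.
Qed.

(** The members of the family form a set whose cardinality may drop, since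
    repetitions are identified. *)
Lemma subfamily_of_indexed (D : {fset Z2}) (I : finType)
    (w : I -> Z2 -> set X) : indexed_cover D w ->
  exists m, (m <= #|I|)%N /\ subcover_sizes D m.
Proof.
move=> [wU wcov].
pose W i : set X := \bigcap_(g in [set` D]) (T (- g) @` w i g).
have Wle : (range W #<= `I_#|I|)%card.
  have -> : range W = range (W \o enum_val (A := I)).
    apply/seteqP; split=> _ [i _ <-]; last by exists (enum_val i).
    by exists (enum_rank i) => //=; rewrite enum_rankK.
  by rewrite (card_le_eqr card_II); exact: card_image_le.
have [m Sm] : finite_set (range W) by exact: finite_image.
exists m; split; first by rewrite -card_le_II -(card_le_eql Sm).
exists (range W); split => //.
  by move=> _ [i _ <-]; exists (w i); split => // g; exact: wU.
apply/seteqP; split=> // z _; have [i iz] := wcov z.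
by exists (W i); [exists i|apply/join_member].
Qed.

Lemma cover_number_le (D : {fset Z2}) (I : finType) (w : I -> Z2 -> set X) :
  indexed_cover D w -> (cover_number D <= #|I|)%N.
Proof.
move=> /subfamily_of_indexed[m [mI Sm]]; apply: leq_trans mI.
by have [] := @nat_minP (subcover_sizes D) _ Sm.
Qed.

(** The cover by all itineraries shows that the minimum is attained. *)
Lemma cover_number_ex (D : {fset Z2}) :
  exists w : 'I_(cover_number D) -> Z2 -> set X, indexed_cover D w.
Proof.
pose I : finType := {ffun D -> bool}.
pose w0 (f : I) g := if insub g is Some d then if f d then A else B else A.
have w0cov : indexed_cover D w0.
  split=> [f g gD|z].
    rewrite /w0 insubT/=; case: (f _); [by left|by right].
  exists [ffun d : D => `[< A (T (val d) z) >]] => g gD.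
  rewrite /w0 insubT/= ffunE/=; case: asboolP => // nA.
  have : (A `|` B) (T g z) by rewrite AB.
  by case.
have [m [_ Sm]] := subfamily_of_indexed w0cov.
have [{m Sm}[S [SU Sm SX]] _] := @nat_minP (subcover_sizes D) _ Sm.
have /card_set_bijP[f [fS _ fsurj]] : (`I_(cover_number D) #= S)%card.
  by rewrite card_eq_sym.
have {}fS (i : 'I_(cover_number D)) : exists u : Z2 -> set X,
    (forall g, g \in D -> U (u g)) /\
    f i = \bigcap_(g in [set` D]) (T (- g) @` u g).
  by apply: SU; apply: fS => /=.
have [w Hw] := choice fS; exists w; split=> [i|z]; first exact: (Hw i).1.
have : (\bigcup_(W in S) W) z by rewrite SX.
move=> [W SW Wz]; have [k /= kN fk] := fsurj _ SW.
exists (Ordinal kN); apply/join_member.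
by rewrite -(Hw (Ordinal kN)).2/= fk.
Qed.

Lemma cover_number_gt0 (z : X) D : (0 < cover_number D)%N.
Proof.
have [w [_ /(_ z)[i _]]] := cover_number_ex D.
exact: leq_ltn_trans (ltn_ord i).
Qed.

Lemma cover_number_fset0 (z : X) : cover_number fset0 = 1%N.
Proof.
apply/eqP; rewrite eqn_leq cover_number_gt0// andbT.
rewrite -card_unit; apply: (@cover_number_le _ _ (fun _ _ => A)).
by split=> // ?; exists tt.
Qed.

Lemma cover_number_mono (D E : {fset Z2}) : (D `<=` E)%fset ->
  (cover_number D <= cover_number E)%N.
Proof.
move=> /fsubsetP DE; rewrite -[leqRHS]card_ord.
have [w [wU wcov]] := cover_number_ex E.
apply: (@cover_number_le _ _ w); split=> [i g /DE|z]; first exact: wU.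
by have [i Hi] := wcov z; exists i => g /DE; exact: Hi.
Qed.

Lemma cover_number_submul (D E : {fset Z2}) :
  (cover_number (D `|` E)%fset <= cover_number D * cover_number E)%N.
Proof.
have [v [vU vcov]] := cover_number_ex D.
have [w [wU wcov]] := cover_number_ex E.
rewrite -[in leqRHS](card_ord (cover_number D)).
rewrite -[in leqRHS](card_ord (cover_number E)) -card_prod.
pose vw ij g := if g \in D then v ij.1 g else w ij.2 g.
apply: (@cover_number_le _ _ vw); rewrite /vw.
split=> [[i j] g|z].
  rewrite in_fsetU; case: ifPn => /= [gD _|_]; [exact: vU|exact: wU].
have [i Hi] := vcov z; have [j Hj] := wcov z.
exists (i, j) => g; rewrite in_fsetU.
by case: ifPn => /= [gD _|_]; [exact: Hi|exact: Hj].
Qed.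

Lemma cover_number_translate g (D : {fset Z2}) :
  cover_number (translate g D) = cover_number D.
Proof.
have le h E : (cover_number (translate h E) <= cover_number E)%N.
  rewrite -[leqRHS]card_ord; have [w [wU wcov]] := cover_number_ex E.
  apply: (@cover_number_le _ _ (fun i k => w i (k - h))).
  split=> [i k|z]; first by rewrite in_translate; exact: wU.
  have [i Hi] := wcov (T h z); exists i => k; rewrite in_translate => kh.
  by have := Hi _ kh; rewrite -TD subrK.
apply/eqP; rewrite eqn_leq le/=.
have {1}-> : D = translate (- g) (translate g D).
  by apply/fsetP => c; rewrite !in_translate opprK addrK.
exact: le.
Qed.

(** Distinct assignments on an independent set cannot be covered by the same
    member of the join. *)
Lemma cover_number_independent (D J : {fset Z2}) (z : {ffun J -> bool} -> X) :
  (J `<=` D)%fset ->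
  (forall (s : {ffun J -> bool}) (j : J),
    (if s j then ~` A else ~` B) (T (val j) (z s))) ->
  (2 ^ #|` J| <= cover_number D)%N.
Proof.
move=> /fsubsetP JD zs; have [w [wU wcov]] := cover_number_ex D.
have [i Hi] := choice (fun s => wcov (z s)).
suff iinj : injective i.
  by have := leq_card i iinj; rewrite card_ffun card_bool card_ord cardfE.
move=> s s' ss'; apply/ffunP => j.
have jD : val j \in D by apply: JD; exact: valP.
have := Hi s _ jD; have := Hi s' _ jD; rewrite ss'.
have := zs s j; have := zs s' j.
by have [->|->] := wU (i s') _ jD; case: (s j) (s' j) => [] [].
Qed.

Lemma cover_number_le2 (D : {fset Z2}) :
  (forall z, (forall g, A (T g z)) \/ (forall g, B (T g z))) ->
  (cover_number D <= 2)%N.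
Proof.
move=> dich; rewrite -card_bool.
apply: (@cover_number_le _ _ (fun (b : bool) _ => if b then A else B)).
split=> [[] g _|z]; [by left|by right|].
by have [Az|Bz] := dich z; [exists true|exists false].
Qed.

Section Entropy.
Variables (R : realType) (F : nat -> {fset Z2}).
Hypothesis folF : Folner R F.

Let phi (D : {fset Z2}) : R := ln (cover_number D)%:R.

Lemma htop_cvg (z : X) :
  cvgn (fun n => ln (cover_number (F n))%:R / #|` F n|%:R : R).
Proof.
apply: (@ornstein_weiss R phi F) => //.
- by rewrite /phi (cover_number_fset0 z) ln1.
- move=> D E DE; rewrite /phi ler_ln ?posrE ?ltr0n ?cover_number_gt0//.
  by rewrite ler_nat cover_number_mono.
- move=> D E; rewrite /phi -lnM ?posrE ?ltr0n ?cover_number_gt0// -natrM.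
  rewrite ler_ln ?posrE ?ltr0n ?muln_gt0 ?cover_number_gt0//.
  by rewrite ler_nat cover_number_submul.
- by move=> g D; rewrite /phi cover_number_translate.
Qed.

Lemma htop_gt0_of_independence (z : X) (M : nat) : (0 < M)%N ->
  (forall D : {fset Z2}, exists J : {fset Z2},
    [/\ (J `<=` D)%fset, (#|` D| <= M * #|` J|)%N &
      exists z : {ffun J -> bool} -> X, forall (s : {ffun J -> bool}) (j : J),
        (if s j then ~` A else ~` B) (T (val j) (z s))]) ->
  0 < htop R F T U.
Proof.
move=> M0 indep; have cvg := htop_cvg z.
have l2 : 0 < ln 2 / M%:R :> R.
  by rewrite divr_gt0 ?ltr0n// ln_gt0// ltr1n.
apply: lt_le_trans l2 _; apply: limr_ge => //; apply: nearW => n.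
have [J [JD DJ [w zw]]] := indep (F n).
have F0 : 0 < #|` F n|%:R :> R by exact: folner_gt0.
rewrite ler_pdivrMr ?ltr0n// [_ * M%:R]mulrAC ler_pdivlMr//.
have := cover_number_independent JD zw; rewrite -(ler_nat R) => c2.
have : ln (2 ^ #|` J|)%:R <= ln (cover_number (F n))%:R :> R.
  by rewrite ler_ln ?posrE ?ltr0n ?expn_gt0 ?cover_number_gt0.
rewrite natrX lnXn ?ltr0n// -[X in X <= _]mulr_natr => lnJ.
move: DJ; rewrite -(ler_nat R) natrM => DJ.
have l20 : 0 <= ln 2 :> R by rewrite ln_ge0// ler1n.
have h1 := ler_wpM2l l20 DJ; have h2 := ler_wpM2r (ler0n R M) lnJ.
rewrite -/(cover_number (F n)); lra.
Qed.

(** The cover numbers stay at most 2 while the Folner sets grow. *)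
Lemma htop_eq0_of_dichotomy (z : X) :
  (forall z, (forall g, A (T g z)) \/ (forall g, B (T g z))) ->
  htop R F T U = 0.
Proof.
move=> dich; apply/cvg_lim => //.
apply/cvgrPdist_le => e e0.
have l20 : 0 <= ln 2 :> R by rewrite ln_ge0// ler1n.
pose M := (Num.truncn (ln 2 / e : R)).+1.
have : \forall n \near \oo, (M <= #|` F n|)%N.
  exact: folner_card_unbounded folF.
apply: filterS => n; rewrite -(ler_nat R) => MF.
have F0 : 0 < #|` F n|%:R :> R by exact: folner_gt0.
have c0 : 0 < (cover_number (F n))%:R :> R by rewrite ltr0n cover_number_gt0.
have l0 : 0 <= ln (cover_number (F n))%:R :> R.
  by rewrite ln_ge0// ler1n cover_number_gt0.
rewrite sub0r normrN ger0_norm ?divr_ge0// ler_pdivrMr//.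
apply: (@le_trans _ _ (ln 2)).
  by rewrite ler_ln ?posrE// ler_nat cover_number_le2.
rewrite -ler_pdivrMl// mulrC; apply: le_trans MF.
by rewrite ltW// -truncn_lt_nat// divr_ge0// ltW.
Qed.

End Entropy.
End CoverNumber.

(** * The hierarchy and the topology of subshifts *)

(** If disjoint neighborhoods of the coordinates of a pair witness that it is
    not an entropy pair, they also do so for every nearby pair. *)
Lemma closed_entropy_pairs (R : realType) (F : nat -> {fset Z2})
    (X : topologicalType) (T : Z2 -> X -> X) :
  closed (entropy_pairs R F T `|` diagonal).
Proof.
rewrite -[_ `|` _]setCK closedC openE => p pE.
have p12 : p.1 <> p.2 by move=> ?; apply: pE; right.
have [Ux [Uy [cUx nUx cUy nUy [dis h0]]]] : exists Ux Uy,
    [/\ closed Ux, nbhs p.1 Ux, closed Uy, nbhs p.2 Uy &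
        Ux `&` Uy = set0 /\ ~ 0 < htop R F T [set ~` Ux; ~` Uy]].
  apply: contrapT => H; apply: pE; left; split=> // Ux Uy ? ? ? ? ?.
  by apply: contrapT => ?; apply: H; exists Ux, Uy; split.
rewrite /interior.
exists (Ux°, Uy°); first by split; exact: nbhs_interior.
move=> q /= [q1 q2] [[_ qE]|qd].
  by apply: h0; apply: qE.
have : (Ux `&` Uy) q.1.
  by split; [exact: interior_subset|rewrite qd; exact: interior_subset].
by rewrite dis.
Qed.

Section Cylinders.
Variable A : finType.

Lemma nbhs_coord (x : config A) (c : Z2) :
  nbhs x [set y : config A | y c = x c].
Proof.
have : nbhs (x c : discrete_topology A) [set x c] by exact: discrete_set1.
exact: (@proj_continuous Z2 (fun=> discrete_topology A) c x).
Qed.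

Definition agree (n : nat) (x y : Z2 -> A) : Prop :=
  forall a b : int, `|a| <= n%:Z -> `|b| <= n%:Z -> y (a, b) = x (a, b).

Lemma agreeW m n (x y : Z2 -> A) : (m <= n)%N -> agree n x y -> agree m x y.
Proof.
move=> mn xy a b am bm; apply: xy; [apply: le_trans am _|apply: le_trans bm _];
by rewrite lez_nat.
Qed.

(** The sets containing all configurations that agree with [x] on some box form
    a filter converging to [x] in every coordinate. *)
Lemma nbhs_config_box (x : config A) (U : set (config A)) :
  nbhs x U -> exists n, forall y, agree n x y -> U y.
Proof.
pose G : set_system (config A) :=
  [set V | exists n, forall y, agree n x y -> V y].
have GF : Filter G.
  split; first by exists 0%N.
    move=> V W [m Vm] [n Wn]; exists (maxn m n) => y xy.
    split; [apply: Vm|apply: Wn]; apply: agreeW xy;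
    by rewrite leq_max leqnn ?orbT.
  by move=> V W VW [m Vm]; exists m => y /Vm/VW.
suff Gx : G --> x by move=> /Gx.
apply/cvg_sup => -[a b] V; rewrite nbhsE => -[W [[B oB <-] Bx] WV].
exists (maxn `|a|%N `|b|%N) => y xy; apply: WV => /=.
rewrite /preimage/= xy//; lia.
Qed.

Variable X : subshift A.

Lemma nbhs_subshift_box (x : set_type X) (U : set (set_type X)) :
  nbhs x U -> exists n, forall y : set_type X, agree n (val x) (val y) -> U y.
Proof.
rewrite nbhsE => -[W [[B oB <-] Bx] WU].
have [n Bn] : exists n, forall y, agree n (val x) y -> B y.
  by apply: nbhs_config_box; rewrite nbhsE; exists B.
by exists n => y /Bn By; apply: WU.
Qed.

Lemma subshift_symbol_clopen (c : Z2) (a : A) :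
  open [set y : set_type X | val y c = a] /\
  closed [set y : set_type X | val y c = a].
Proof.
have op (P : set A) : open [set y : set_type X | P (val y c)].
  exists [set y : config A | P (y c)] => //.
  rewrite openE => y Py; have := nbhs_coord y c; by apply: filterS => z /= ->.
split; first exact: (op [set a]).
by rewrite -[X in closed X]setCK closedC; exact: (op [set~ a]).
Qed.

(** If the rule fails somewhere, the failure is visible in a finite window. *)
Lemma closed_locally_determined (D : seq Z2) (good : (Z2 -> A) -> Prop) :
  (forall x y : Z2 -> A, {in D, x =1 y} -> good x -> good y) ->
  closed [set x : config A | forall g, good (fun h => x (g + h))].
Proof.
move=> local; rewrite -[X in closed X]setCK closedC openE => x /existsNP[g ng].
have : nbhs x [set y : config A | {in D, forall h, y (g + h) = x (g + h)}].
  elim: D {local} => [|h D IH]; first by apply: (@filterE _ (nbhs x)) => y k.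
  apply: (@filterS _ (nbhs x) _ _ _ _ (filterI (nbhs_coord x (g + h)) IH)).
  move=> y [/= yh yD] k.
  by rewrite inE => /predU1P[->|/yD].
apply: (@filterS _ (nbhs x)) => y xy /(_ g) gy; apply: ng; apply: local gy.
by move=> h hD; exact: xy.
Qed.

(** The forbidden patterns are the restrictions to the window of the
    configurations that break the rule at the origin. *)
Lemma is_SFT_locally_determined (D : {fset Z2}) (good : (Z2 -> A) -> Prop) :
  (forall x y : Z2 -> A, {in D, x =1 y} -> good x -> good y) ->
  is_SFT [set x : config A | forall g, good (fun h => x (g + h))].
Proof.
move=> local.
pose pat (f : {ffun D -> A}) : {fmap Z2 -> A} := [fmap h : D => f h]%fmap.
pose res (x : Z2 -> A) : {ffun D -> A} := [ffun h : D => x (val h)].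
have patE x h : h \in D -> ((pat (res x)).[? h] = Some (x h))%fmap.
  by move=> hD; rewrite /pat (in_fnd (_ : h \in domf _)) !ffunE.
pose bad := seq_fset tt [seq pat f | f <- enum {ffun D -> A} &
  `[< exists x, f = res x /\ ~ good x >]].
have badP p : reflect (exists2 x, p = pat (res x) & ~ good x) (p \in bad).
  rewrite seq_fsetE; apply: (iffP mapP) => [[f + ->]|[x -> ngx]].
    by rewrite mem_filter => /andP[/asboolP[x [-> ngx]] _]; exists x.
  exists (res x) => //; rewrite mem_filter mem_enum andbT.
  by apply/asboolP; exists x.
exists bad; apply/seteqP; split=> x /=.
  move=> gx p /badP[y -> ngy] [g gp].
  apply: ngy; apply: local (gx g) => h hD.
  by have := gp h hD; rewrite patE// => -[].
move=> nx g; apply: contrapT => ng.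
apply: (nx (pat (res (fun h => x (g + h))))); first by apply/badP; eexists.
by exists g => h hD; rewrite patE.
Qed.

Lemma sigma_invariant_locally_determined (good : (Z2 -> A) -> Prop) g x :
  [set x : config A | forall g, good (fun h => x (g + h))] x ->
  [set x : config A | forall g, good (fun h => x (g + h))] (sigma g x).
Proof.
move=> gx k /=; have := gx (- g + k).
by under eq_fun do rewrite -addrA.
Qed.

End Cylinders.

(** * The subshift of paths *)

(** The two directions are transposed of each other, so paths of direction [d]
    are described in coordinates [a] along and [b] across that direction. *)
Definition cell (d : bool) (a b : int) : Z2 := if d then (b, a) else (a, b).

Lemma cellD d a b a' b' : cell d (a + a') (b + b') = cell d a b + cell d a' b'.
Proof. by case: d. Qed.

Lemma cell_inj d a b a' b' : cell d a b = cell d a' b' -> a = a' /\ b = b'.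
Proof. by case: d => -[-> ->]. Qed.

(** [Some false] is an H, [Some true] a V. Advancing by two while drifting by at
    most one is what makes an H-path and a V-path converge on each other. *)
Definition path_rule (x : Z2 -> option bool) : Prop :=
  forall d, x 0 = Some d ->
    (forall e : int, e = 2 \/ e = - 2 ->
       exists2 f : int, `|f| <= 1 & x (cell d e f) = Some d) /\
    (forall a b : int, `|a| <= 1 -> `|b| <= 1 -> x (a, b) <> Some (~~ d)).

Definition window (n : nat) : {fset Z2} :=
  [fset (i%:Z - n%:Z, j%:Z - n%:Z)%R
    | i in iota 0 (n.*2.+1), j in iota 0 (n.*2.+1)]%fset.

Lemma mem_window n (a b : int) :
  `|a| <= n%:Z -> `|b| <= n%:Z -> (a, b) \in window n.
Proof.
move=> an bn; apply/imfset2P; exists `|(a + n%:Z)%R|%N.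
  by rewrite mem_iota; lia.
exists `|(b + n%:Z)%R|%N; first by rewrite mem_iota; lia.
congr (_, _); lia.
Qed.

Lemma path_rule_local (x y : Z2 -> option bool) :
  {in window 2, x =1 y} -> path_rule x -> path_rule y.
Proof.
move=> xy gx d; rewrite -xy ?mem_window// => /gx[step excl]; split.
  move=> e He; have [f f1 xf] := step e He; exists f => //.
  rewrite -xy//; case: (d) => /=; apply: mem_window; lia.
by move=> a b a1 b1; rewrite -xy; [exact: excl|apply: mem_window; lia].
Qed.

Definition path_subshift : subshift (option bool) :=
  Subshift (closed_locally_determined path_rule_local)
    (@sigma_invariant_locally_determined _ path_rule).

Lemma path_step (x : config (option bool)) d (a b e : int) :
  carrier path_subshift x ->
  x (cell d a b) = Some d -> e = 2 \/ e = - 2 ->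
  exists2 f : int, `|f| <= 1 & x (cell d (a + e) (b + f)) = Some d.
Proof.
move=> Xx xab He; have [|step _] := Xx (cell d a b) d; first by rewrite addr0.
by have [f f1 xf] := step e He; exists f => //; rewrite cellD.
Qed.

(** Move the H horizontally towards the V if they are at least two columns
    apart, otherwise the V vertically towards the H: the distance along the
    move drops by two and the other one grows by at most one. They end up
    within distance one, which is forbidden. *)
Lemma no_crossing (x : config (option bool)) (h v : Z2) :
  carrier path_subshift x ->
  x h = Some false -> x v = Some true -> False.
Proof.
move=> Xx; case: h v => [a b] [c d].
have [n] := ubnP (`|(c - a)%R| + `|(d - b)%R|)%N.
elim: n a b c d => // n IH a b c d.
move=> dist xh xv.
have [hor|hor] := leP 2 `|c - a|.
  have [ac|ac] := leP a c.
    have [f f1 xf] := @path_step x false a b 2 Xx xh (or_introl erefl).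
    by apply: (IH _ _ _ _ _ xf xv); lia.
  have [f f1 xf] := @path_step x false a b (- 2) Xx xh (or_intror erefl).
  by apply: (IH _ _ _ _ _ xf xv); lia.
have [ver|ver] := leP 2 `|d - b|.
  have [bd|bd] := leP b d.
    have [f f1 xf] := @path_step x true d c (- 2) Xx xv (or_intror erefl).
    by apply: (IH _ _ _ _ _ xh xf); lia.
  have [f f1 xf] := @path_step x true d c 2 Xx xv (or_introl erefl).
  by apply: (IH _ _ _ _ _ xh xf); lia.
have [|_ excl] := Xx (a, b) false; first by rewrite addr0.
apply: (excl (c - a) (d - b)); [lia|lia|].
have -> // : (a, b) + (c - a, d - b) = (c, d).
by apply: (f_equal2 pair); rewrite /= addrC subrK.
Qed.

Lemma one_direction (x : config (option bool)) : carrier path_subshift x ->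
  exists d, forall c, x c <> Some (~~ d).
Proof.
move=> Xx; have [[h xh]|nh] := pselect (exists h, x h = Some false).
  by exists false => v; exact: (no_crossing Xx xh).
by exists true => h xh; apply: nh; exists h.
Qed.

(** * Splicing patterns of paths *)

(** Paths are bent by clamping heights between a constant ceiling [n + 1] and a
    floor that rises with slope one half. The floor lies below the box of radius
    [n] near the origin and has reached the ceiling at distance [6 n + 4], so
    that there all paths are squeezed into the single row [n + 1]. *)
Definition squeeze (n : nat) (a b : int) : int :=
  Num.min (n%:Z + 1) (Num.max b ((`|a|%N %/ 2)%N%:Z - (2 * n%:Z + 1))).

Lemma squeeze_step n (a b e f : int) : e = 2 \/ e = - 2 -> `|f| <= 1 ->
  `|squeeze n (a + e) (b + f) - squeeze n a b| <= 1.
Proof. by rewrite /squeeze => -[->|->]; lia. Qed.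

Lemma squeeze_in_box n (a b : int) : `|a| <= n%:Z -> `|b| <= n%:Z ->
  squeeze n a b = b.
Proof. by rewrite /squeeze; lia. Qed.

(** Boxes of radius [n] centred on a lattice of spacing [10 (n + 1)]: in another
    row of boxes the squeezed paths are out of reach, and in another box of the
    same row they have already been squeezed into the row [n + 1], just above
    the box. *)
Lemma squeeze_meets_box n (a b a0 b0 k l : int) :
  `|a| <= n%:Z -> `|b| <= n%:Z ->
  a0 = a + (10 * n.+1)%N%:Z * k -> squeeze n a0 b0 = b + (10 * n.+1)%N%:Z * l ->
  [/\ k = 0, l = 0 & b0 = b].
Proof.
move=> an bn a0E b0E.
have l0 : l = 0.
  have lo : - (2 * n%:Z + 1) <= squeeze n a0 b0 by rewrite /squeeze; lia.
  have hi : squeeze n a0 b0 <= n%:Z + 1 by rewrite /squeeze; lia.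
  have [l1|l1|//] := ltgtP l 0.
    have : (10 * n.+1)%N%:Z * l <= - (10 * n.+1)%N%:Z by nia.
    by lia.
  have : (10 * n.+1)%N%:Z <= (10 * n.+1)%N%:Z * l by nia.
  by lia.
have k0 : k = 0.
  have far : k != 0 -> 9 * n%:Z + 10 <= `|a0|.
    move=> kN0.
    have : (10 * n.+1)%N%:Z <= `|(10 * n.+1)%N%:Z * k|.
      by rewrite normrM ger0_norm//; nia.
    by lia.
  have [//|/far a0far] := eqVneq k 0.
  by move: b0E; rewrite l0 mulr0 addr0 /squeeze; lia.
split=> //; move: b0E; rewrite a0E k0 l0 !mulr0 !addr0 /squeeze; lia.
Qed.

Section Splice.
Variables (x : config (option bool)) (d : bool) (n : nat).
Hypothesis Xx : carrier path_subshift x.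
Hypothesis xd : forall c, x c <> Some (~~ d).

Let spacing : int := (10 * n.+1)%N%:Z.

(** Place at each [p] in [P] the paths of [x], squeezed around [p]. *)
Definition splice (P : set Z2) : config (option bool) := fun c =>
  if `[< exists2 p, P p & exists a b, x (cell d a b) = Some d /\
         c = p + cell d a (squeeze n a b) >] then Some d else None.

Lemma spliceP P c e : splice P c = Some e -> e = d /\
  exists2 p, P p & exists a b, x (cell d a b) = Some d /\
         c = p + cell d a (squeeze n a b).
Proof. by rewrite /splice; case: asboolP => // H [<-]. Qed.

(** Clamping between bounds that move by at most one in two columns does not
    enlarge the drift of a path, so squeezed paths are paths; a union of paths
    of the same direction obeys the rule. *)
Lemma splice_in_subshift P : carrier path_subshift (splice P).
Proof.
move=> g e; rewrite addr0 => /spliceP[-> [p Pp [a [b [xab gE]]]]]; split.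
  move=> s Hs; have [f f1 xf] := path_step Xx xab Hs.
  exists (squeeze n (a + s) (b + f) - squeeze n a b); first exact: squeeze_step.
  rewrite /splice asboolT//; exists p => //.
  exists (a + s), (b + f); split=> //.
  by rewrite gE -addrA -cellD; congr (_ + cell d _ _); rewrite addrC subrK.
move=> a' b' _ _; rewrite /splice; case: asboolP => // _ [].
by case: (d).
Qed.

(** A path squeezed around one site of a lattice avoids the boxes around the
    others, so the box at [q] only depends on whether [q] is in [P]. *)
Lemma splice_agree (Q P : set Z2) q : P `<=` Q ->
  (forall p q, Q p -> Q q -> exists k l, q - p = (spacing * k, spacing * l)) ->
  Q q ->
  forall a b : int, `|a| <= n%:Z -> `|b| <= n%:Z ->
  splice P (q + (a, b)) = if `[< P q >] then x (a, b) else None.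
Proof.
move=> PQ Qmod Qq a0 b0 a0n b0n.
have [a [b [cE an bn]]] : exists a b, [/\ (a0, b0) = cell d a b,
    `|a| <= n%:Z & `|b| <= n%:Z].
  by case: (d); [exists b0, a0|exists a0, b0].
rewrite cE.
have -> : (if `[< P q >] then x (cell d a b) else None) =
    if `[< P q /\ x (cell d a b) = Some d >] then Some d else None.
  have [Pq|Pq] := pselect (P q); last by rewrite (asboolF Pq) asboolF// => -[].
  rewrite (asboolT Pq); case: asboolP => [[]//|nP].
  case E : (x _) => [e|//]; case: nP; split=> //; rewrite E; congr Some.
  have := xd (c := cell d a b); rewrite E.
  by case: (e) (d) => [] [] // H; case: H.
rewrite /splice; congr (if _ then _ else _).
apply/asbool_equiv_eq; split; last first.
  move=> [Pq xab]; exists q => //; exists a, b; split=> //.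
  by rewrite squeeze_in_box.
move=> [p Pp [a' [b' [xab' qE]]]].
have [k [l kl]] : exists k l, q - p = cell d (spacing * k) (spacing * l).
  have [k [l ->]] := Qmod _ _ (PQ _ Pp) Qq.
  by case: (d); [exists l, k|exists k, l].
have [a'E b'E] : a' = a + spacing * k /\ squeeze n a' b' = b + spacing * l.
  apply: (@cell_inj d); rewrite cellD -kl; apply: (addrI p).
  by rewrite -qE addrCA [p + _]addrC subrK addrC.
have [k0 l0 b'0] := squeeze_meets_box an bn a'E b'E.
have pq : p = q.
  by apply/esym/eqP; rewrite -subr_eq0 kl k0 l0 !mulr0; case: (d).
by rewrite -pq; split=> //; move: xab'; rewrite a'E k0 b'0 mulr0 addr0.
Qed.

End Splice.

(** The most populated residue class modulo [m + 1]. *)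
Lemma residue_class_dense (D : {fset Z2}) (m : nat) : exists J : {fset Z2},
  [/\ (J `<=` D)%fset, (#|` D| <= m.+1 * m.+1 * #|` J|)%N &
    forall p q, p \in J -> q \in J ->
      exists k l, q - p = (m.+1%:Z * k, m.+1%:Z * l)].
Proof.
pose J (r : 'I_m.+1 * 'I_m.+1) : {fset Z2} := [fset c in D |
  (c.1 == r.1%:Z %[mod m.+1%:Z])%Z && (c.2 == r.2%:Z %[mod m.+1%:Z])%Z]%fset.
have [r0 _ rmax] := @arg_maxnP _ (ord0, ord0) xpredT (fun r => #|` J r|) isT.
exists (J r0); split.
- by apply/fsubsetP => c; rewrite /J in_fset/= inE => /andP[].
- have H : (#|` D| <= \sum_(r <- enum {: 'I_m.+1 * 'I_m.+1}) #|` J r|)%N.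
    apply: card_bigfcup_le => c cD.
    have res (z : int) : {i : 'I_m.+1 | (z == i%:Z %[mod m.+1%:Z])%Z}.
      have z0 : 0 <= (z %% m.+1%:Z)%Z by rewrite modz_ge0.
      have zm : (`|(z %% m.+1%:Z)%Z|%N < m.+1)%N.
        by rewrite -ltz_nat gez0_abs// ltz_pmod.
      by exists (Ordinal zm) => /=; rewrite gez0_abs// modz_mod.
    apply/hasP; have [i Hi] := res c.1; have [j Hj] := res c.2.
    exists (i, j); first by rewrite mem_enum.
    by rewrite /J in_fset/= inE/= cD Hi Hj.
  apply: leq_trans H _.
  apply: (@leq_trans (\sum_(r <- enum {: 'I_m.+1 * 'I_m.+1}) #|` J r0|)%N).
    by apply: leq_sum => r _; exact: rmax.
  by rewrite big_const_seq count_predT iter_addn_0 -cardE card_prod card_ord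
    mulnC.
- move=> p q; rewrite /J !in_fset/= !inE => /and3P[_ p1 p2] /and3P[_ q1 q2].
  have div (u v w : int) : (u == w %[mod m.+1%:Z])%Z ->
      (v == w %[mod m.+1%:Z])%Z -> exists k, v - u = m.+1%:Z * k.
    move=> /eqP uw /eqP vw; exists ((v %/ m.+1%:Z)%Z - (u %/ m.+1%:Z)%Z).
    rewrite {1}(divz_eq v m.+1%:Z) {1}(divz_eq u m.+1%:Z) uw vw.
    by rewrite mulrBr ![m.+1%:Z * _]mulrC; lia.
  have [k kE] := div _ _ _ p1 q1; have [l lE] := div _ _ _ p2 q2.
  by exists k, l; rewrite -kE -lE.
Qed.

Definition empty_config : config (option bool) := fun=> None.

Lemma empty_in_subshift : carrier path_subshift empty_config.
Proof. by []. Qed.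

Lemma constant_in_subshift d :
  carrier path_subshift ((fun=> Some d) : config (option bool)).
Proof.
move=> g e [<-]; split; first by move=> s _; exists 0.
by move=> a b _ _ [] /eqP; case: d.
Qed.

Local Notation point := (set_type path_subshift).
Local Notation act := (@subshift_act _ path_subshift).

Definition to_point x (Xx : carrier path_subshift x) : point :=
  exist _ x (mem_set Xx).

Lemma act0 (x : point) : act 0 x = x.
Proof.
apply: val_inj => /=; apply/funext => h.
by rewrite /sigma oppr0 add0r.
Qed.

Lemma actD g h (x : point) : act (g + h) x = act g (act h x).
Proof.
apply: val_inj => /=; apply/funext => k.
by rewrite /sigma opprD addrAC addrC !addrA.
Qed.

(** * Entropy pairs of the subshift of paths *)

(** On a residue class [J] of times, an assignment is realised by splicing
    [x] at the sites where [Ux] is to be visited. The shift by [g] reads the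
    configuration around [- g], so the sites are the opposites of the times. *)
Lemma entropy_pair_empty (R : realType) (F : nat -> {fset Z2}) (x : point) :
  Folner R F -> x <> to_point empty_in_subshift ->
  entropy_pairs R F act (x, to_point empty_in_subshift).
Proof.
move=> folF x0; split=> //= Ux U0 cUx nUx cU0 nU0 dis.
have [n1 U1] := @nbhs_subshift_box _ path_subshift _ _ nUx.
have [n2 U2] := @nbhs_subshift_box _ path_subshift _ _ nU0.
pose n := maxn n1 n2; pose m := (10 * n + 9)%N.
have mE : m.+1 = (10 * n.+1)%N by rewrite /m; lia.
have [d xd] := one_direction (set_valP x).
have AB : ~` Ux `|` ~` U0 = setT by rewrite -setCI dis setC0.
have M0 : (0 < m.+1 * m.+1)%N by [].
apply: (htop_gt0_of_independence act0 actD AB folF x M0).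
move=> D; have [J [JD DJ Jmod]] := residue_class_dense D m.
exists J; split=> //.
pose P (s : {ffun J -> bool}) : set Z2 :=
  [set p | exists2 j : J, s j & p = - val j].
exists (fun s =>
  to_point (@splice_in_subshift _ d n (set_valP x) (P s))) => s j.
have Qmod p q : [set - c | c in [set` J]] p -> [set - c | c in [set` J]] q ->
    exists k l, q - p = ((10 * n.+1)%N%:Z * k, (10 * n.+1)%N%:Z * l).
  move=> [c cJ <-] [c' c'J <-]; have [k [l E]] := Jmod _ _ c'J cJ.
  by exists k, l; rewrite -mE -E opprK addrC.
have PQ : P s `<=` [set - c | c in [set` J]].
  by move=> _ [i _ ->]; exists (val i) => //; exact: (valP i).
have agr := splice_agree xd PQ Qmod (ex_intro2 _ _ (val j) (valP j) erefl).
have Pj : P s (- val j) <-> s j.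
  split=> [[i si]|sj]; last by exists j.
  by move=> /oppr_inj/val_inj ->.
case: ifP => sj; rewrite setCK.
  apply: U1; apply: (@agreeW _ _ n); first by rewrite leq_max leqnn.
  by move=> a b an bn; rewrite /= /sigma agr// asboolT//; apply/Pj.
apply: U2; apply: (@agreeW _ _ n); first by rewrite leq_max leqnn orbT.
move=> a b an bn; rewrite /= /sigma agr// asboolF//.
by move=> /Pj; rewrite sj.
Qed.

Theorem corollary5p13 (R : realType) :
  exists (A : finType) (X : subshift A),
    is_SFT X /\
    forall F : nat -> {fset Z2}, Folner R F ->
      CPE_class R F (@subshift_act A X) 2.
Proof.
exists (option bool : finType), path_subshift; split.
  exact: is_SFT_locally_determined path_rule_local.
move=> F folF; split=> //.
- rewrite /= asboolT; last exact: closed_entropy_pairs.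
  apply/seteqP; split=> // -[x y] _ S [[Srefl Ssym Strans] ES].
  have toempty z : S (z, to_point empty_in_subshift).
    have [->|z0] := pselect (z = to_point empty_in_subshift).
      exact: Srefl.
    by apply: ES; left; exact: entropy_pair_empty.
  by apply: Strans (toempty x) _; apply: Ssym.
- move=> m /andP[m1 m2]; have -> : m = 1%N by lia.
  move=> /= E1.
  pose x d := to_point (@constant_in_subshift d).
  have : (entropy_pairs R F act `|` diagonal) (x false, x true) by rewrite E1.
  case=> [[_ ent]|/(congr1 (fun z : point => val z 0))//].
  pose V d := [set z : point | val z 0 = Some d].
  have nV d : nbhs (x d) (V d).
    apply: open_nbhs_nbhs; split=> //.
    exact: (@subshift_symbol_clopen _ path_subshift 0 (Some d)).1.
  have cV d : closed (V d).
    exact: (@subshift_symbol_clopen _ path_subshift 0 (Some d)).2.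
  have dis : V false `&` V true = set0.
    by apply/seteqP; split=> // z [zf zt]; have := etrans (esym zf) zt.
  have := ent _ _ (cV false) (nV false) (cV true) (nV true) dis.
  rewrite (htop_eq0_of_dichotomy act0 actD _ folF (x true)) ?ltxx//.
    by rewrite -setCI dis setC0.
  move=> z; have [[] zd] := one_direction (set_valP z).
    by left => g; exact: zd.
  by right => g; exact: zd.
Qed.
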